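(* There exist hereditarily paracompact, first countable, submetrizable topological spaces $\langle X, \tau_X\rangle$ and $\langle Y, \tau_Y\rangle$ and a perfect map $f\colon \langle X, \tau_X\rangle \to \langle Y, \tau_Y\rangle$ such that the triple $\langle f, \langle X, \tau_X\rangle, \langle Y, \tau_Y\rangle\rangle$ is not (perfect)-submetrizable; that is, there do not exist topologies $\sigma_X \subseteq \tau_X$ on $X$ and $\sigma_Y \subseteq \tau_Y$ on $Y$ such that $\langle X, \sigma_X\rangle$ and $\langle Y, \sigma_Y\rangle$ are metrizable and $f\colon \langle X, \sigma_X\rangle \to \langle Y, \sigma_Y\rangle$ is a perfect map.
   Context: A topological space $\langle X,\tau\rangle$ is submetrizable if there is a topology $\sigma\subseteq\tau$ on $X$ such that $\langle X,\sigma\rangle$ is metrizable. A space is hereditarily paracompact if each of its subspaces is paracompact. A map between topological spaces is perfect if it is continuous, closed, and all its point preimages (fibers) are compact; surjectivity is not part of the definition. If $\langle X,\tau_X\rangle$ and $\langle Y,\tau_Y\rangle$ are submetrizable and $f\colon\langle X,\tau_X\rangle\to\langle Y,\tau_Y\rangle$ is perfect, the triple $\langle f,\langle X,\tau_X\rangle,\langle Y,\tau_Y\rangle\rangle$ is called (perfect)-submetrizable if there exist metrizable topologies $\sigma_X\subseteq\tau_X$ on $X$ and $\sigma_Y\subseteq\tau_Y$ on $Y$ such that $f\colon\langle X,\sigma_X\rangle\to\langle Y,\sigma_Y\rangle$ is perfect. *)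

(* Defs.v *)
From HB Require Import structures.
From mathcomp Require Import all_boot all_order all_algebra.
From mathcomp Require Import all_classical all_reals all_analysis.

Set Implicit Arguments.
Unset Strict Implicit.
Unset Printing Implicit Defensive.

Local Open Scope classical_set_scope.
Local Open Scope ring_scope.

(* Several topologies on one carrier [T] are handled as inhabitants of the
   class [Topological.axioms_ T] of the hierarchy.  This class also carries a
   choice structure on [T], on which none of the notions below depends. *)
Definition topology (T : Type) : Type := Topological.axioms_ T.

Definition with_topology (T : Type) (s : topology T) : topologicalType :=
  Topological.Pack s.

Definition coarser_topology (X : topologicalType) (s : topology X) : Prop :=
  @open (with_topology s) `<=` @open X.

(* [Metric.axioms_ R X] is the class of [metricType R] on the carrier of [X]. *)
Definition metrizable (R : realType) (X : topologicalType) : Prop :=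
  exists m : Metric.axioms_ R X,
    @open (Metric.Pack m : metricType R) = @open X.

Definition submetrizable (R : realType) (X : topologicalType) : Prop :=
  exists s : topology X,
    coarser_topology s /\ metrizable R (with_topology s).

Definition first_countable (X : topologicalType) : Prop :=
  forall x : X, exists B : set (set X),
    [/\ countable B, B `<=` nbhs x &
        forall U, nbhs x U -> exists2 V, B V & V `<=` U].

Definition open_covering (X : topologicalType) (F : set (set X)) : Prop :=
  F `<=` open /\ \bigcup_(A in F) A = setT.

Definition refines (T : Type) (G F : set (set T)) : Prop :=
  forall A, G A -> exists2 B, F B & A `<=` B.

Definition locally_finite (X : topologicalType) (F : set (set X)) : Prop :=
  forall x : X, exists2 U, nbhs x U &
    finite_set [set A | F A /\ A `&` U !=set0].

(* The Hausdorff axiom is part of the usual definition of paracompactness; it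
   holds automatically in every subspace of a submetrizable space. *)
Definition paracompact (X : topologicalType) : Prop :=
  hausdorff_space X /\
  forall F : set (set X), open_covering F ->
    exists G : set (set X),
      [/\ open_covering G, refines G F & locally_finite G].

(* [set_type A] is the subtype of elements of [A], with the topology induced by
   its inclusion in [X]; the library's [subspace A] is instead a finer topology
   on the whole of [X]. *)
Definition hereditarily_paracompact (X : topologicalType) : Prop :=
  forall A : set X, paracompact (set_type A).

Definition perfect_map (X Y : topologicalType) (f : X -> Y) : Prop :=
  [/\ continuous f,
      forall A : set X, closed A -> closed (f @` A) &
      forall y : Y, compact (f @^-1` [set y])].

Definition perfect_submetrizable (R : realType) (X Y : topologicalType)
    (f : X -> Y) : Prop :=
  exists (sX : topology X) (sY : topology Y),
    [/\ coarser_topology sX, coarser_topology sY,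
        metrizable R (with_topology sX), metrizable R (with_topology sY) &
        @perfect_map (with_topology sX) (with_topology sY) f].

(* Main.v *)
Require Import Defs.
From HB Require Import structures.
From mathcomp Require Import all_boot all_order all_algebra.
From mathcomp Require Import all_classical all_reals all_analysis.
From mathcomp Require Import borel_hierarchy lra.

(** Let Y be the Michael line: the real line with every irrational made
isolated, the rationals keeping their usual neighbourhoods.  The set Q of
rationals is closed in Y, hence the inclusion f of the subspace Q into Y is a
closed embedding, in particular a perfect map, and its range is Q.

If f stayed perfect for coarser metrizable topologies, its range Q would be
closed, hence a countable intersection of open sets, in a metrizable topology
coarser than that of Y; so Q would be a G-delta of Y
([perfect_submetrizable_Gdelta]).  Replacing each of these open sets by its
interior for the usual topology keeps all of Q, since the two topologies have
the same neighbourhoods at rational points; so Q would be a G-delta of the real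
line ([isolated_off_Gdelta]), which the Baire category theorem forbids.

The positive properties of Q and Y follow from what they have in common: both
inject into a metric space so that the topology is the pulled back one at the
points of a countable set, and discrete at all other points
([metric_or_isolated]).  Such spaces are submetrizable through the injection,
visibly first countable, and the class is stable under subspaces, so that only
paracompactness itself is left to prove ([metric_or_isolated_paracompact]). *)

Set Implicit Arguments.
Unset Strict Implicit.
Unset Printing Implicit Defensive.

Import Order.TTheory GRing.Theory Num.Theory.
Import numFieldTopology.Exports.

Local Open Scope classical_set_scope.
Local Open Scope ring_scope.

(** * Metric spaces *)

Section metric_facts.
Context {R : realType}.

Lemma natSinv_lt (e : R) : 0 < e -> exists n, n.+1%:R^-1 < e.
Proof.
move=> e0; have [N _ /(_ N (leqnn N)) Ne] := near_infty_natSinv_lt (PosNum e0).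
by exists N.
Qed.

Lemma closed_mdist_le (M : metricType R) (a : M) (e : R) :
  closed [set y | mdist a y <= e].
Proof.
rewrite -[X in closed X]setCK; apply: open_closedC.
rewrite openE => y /= /negP; rewrite -ltNge => ey.
apply/nbhs_ballP; exists (mdist a y - e) => /=; first by rewrite subr_gt0.
move=> z; rewrite ballEmdist /= => yz; apply/negP; rewrite -ltNge.
have := metric_triangle a z y; rewrite (metric_sym z y); lra.
Qed.

Lemma open_metric_ball (M : metricType R) (a : M) (e : R) : open (ball a e).
Proof.
rewrite openE => y; rewrite ballEmdist /= => ay.
apply/nbhs_ballP; exists (e - mdist a y) => /=; first by rewrite subr_gt0.
move=> z; rewrite !ballEmdist /= => yz.
have := metric_triangle a y z; lra.
Qed.

Lemma closed_Gdelta (M : pseudoMetricType R) (A : set M) :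
  closed A -> Gdelta A.
Proof.
move=> cA; (* Balls of a pseudometric need not be open, whence the interiors. *)
exists (fun n => \bigcup_(a in A) (ball a n.+1%:R^-1)°).
  by move=> n; apply: bigcup_open => a _; exact: open_interior.
apply/seteqP; split=> [a Aa n _|x Ax].
  by exists a => //; apply: nbhsx_ballx; rewrite invr_gt0.
apply: cA => U /nbhs_ballP[e /= e0 xU].
have [n ne] := natSinv_lt e0.
have [a Aa /interior_subset ax] := Ax n I.
exists a; split=> //; apply: xU.
by apply: ball_sym; apply: le_ball ax; exact: ltW.
Qed.

End metric_facts.

Section pullback_metric.
Context {R : realType} (S : choiceType) (M : metricType R) (g : S -> M).
Hypothesis g_inj : injective g.

(** The proof of injectivity is an argument of the alias so that the metric
structure, which needs it for separation, can be inferred from the type. *)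
Definition pullback_metric of injective g : Type := S.
Local Notation P := (pullback_metric g_inj).

Let d (x y : P) : R := mdist (g x) (g y).

Let dxx x : d x x = 0. Proof. exact: mdistxx. Qed.

Let d_positivity x y : d x y = 0 -> x = y.
Proof. by move=> /mdist_positivity /g_inj. Qed.

Let d_sym x y : d x y = d y x. Proof. exact: metric_sym. Qed.

Let d_triangle y x z : d x z <= d x y + d y z.
Proof. exact: metric_triangle. Qed.

HB.instance Definition _ := Choice.copy P S.
HB.instance Definition _ := isMetric.Build R P dxx d_positivity d_sym d_triangle.

End pullback_metric.

Lemma submetrizable_inj (R : realType) (Z : topologicalType) (M : metricType R)
  (g : Z -> M) : injective g -> continuous g -> submetrizable R Z.
Proof.
move=> g_inj g_cont.
exists (Topological.class (pullback_metric g_inj)); split; last first.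
  by exists (Metric.class (pullback_metric g_inj)).
move=> U Uo; rewrite openE => z Uz.
have [e /= e0 zU] : nbhs_ball (z : pullback_metric g_inj) U.
  by apply/nbhs_ballP; apply: open_nbhs_nbhs.
have : nbhs z (g @^-1` ball (g z) e) by apply: g_cont; exact: nbhsx_ballx.
by apply: filterS => x zx; apply: zU; move: zx; rewrite /= !ballEmdist.
Qed.

(** * Spaces that are metric at countably many points and isolated elsewhere *)

Section metric_or_isolated.
Context {R : realType} (M : metricType R).

(** Countability of [C] makes families of balls around its points countable, and
countable families admit an explicit locally finite refinement, without the
general theorem that metric spaces are paracompact. *)
Definition metric_or_isolated (Z : topologicalType) (g : Z -> M) (C : set Z) :=
  [/\ injective g, countable C, forall z, ~ C z -> nbhs z [set z] &
      forall z U, C z ->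
        nbhs z U <-> exists2 V, nbhs (g z) V & g @^-1` V `<=` U].

Section theory.
Context (Z : topologicalType) (g : Z -> M) (C : set Z).
Hypothesis gC : metric_or_isolated g C.

Let g_inj : injective g. Proof. by case: gC. Qed.

Lemma metric_or_isolated_continuous : continuous g.
Proof.
have [_ _ iso cen] := gC; move=> z V zV.
have [Cz|nCz] := pselect (C z); first by apply/cen => //; exists V.
have Vz := nbhs_singleton zV.
by apply: filterS (iso _ nCz) => _ ->.
Qed.

Lemma metric_or_isolated_hausdorff : hausdorff_space Z.
Proof.
move=> p q pq; apply: g_inj; apply: (@metric_hausdorff R M) => A B Ap Bq.
have gA := metric_or_isolated_continuous Ap.
have gB := metric_or_isolated_continuous Bq.
have [z [Az Bz]] := pq _ _ gA gB.
by exists (g z).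
Qed.

Lemma metric_or_isolated_first_countable : first_countable Z.
Proof.
have [_ _ iso cen] := gC; move=> z.
have [Cz|nCz] := pselect (C z); last first.
  exists [set [set z]]; split; first exact: countable1.
    by move=> _ ->; exact: iso.
  by move=> U zU; exists [set z] => // _ ->; exact: nbhs_singleton.
pose b n := g @^-1` ball (g z) n.+1%:R^-1.
have bz n : nbhs z (b n).
  by apply: metric_or_isolated_continuous; apply: nbhsx_ballx; rewrite invr_gt0.
exists (range b); split; last first.
- move=> U /(cen _ _ Cz)[V /nbhs_ballP[e /= e0 eV] VU].
  have [n ne] := natSinv_lt e0.
  exists (b n); first by exists n.
  by move=> x bx; apply/VU/eV; apply: le_ball bx; exact: ltW.
- by move=> _ [n _ <-].
- exact: card_image_le.
Qed.

(** Given an open cover, choose for each [z] in [C] a ball [B z] inside a member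
of the cover, and number [C] by [c].  Removing from [B z] the balls around the
points numbered before [z], with radii shrunk by [1 / (c z + 1)], gives open
sets [L z] with the same union [W] as the balls: a point of [W] is in [L z] for
the first [z] with that point in [B z].  A point of [B t] lies in a shrunk ball
around [t] that all [L z] with [c z] large avoid, so the [L z] are locally finite
in [W].  The points outside [W] are isolated, and their singletons complete the
refinement. *)
Lemma metric_or_isolated_paracompact : paracompact Z.
Proof.
split=> [|F [Fo Fcov]]; first exact: metric_or_isolated_hausdorff.
have [_ Ccount iso cen] := gC.
have inF z : exists2 A, F A & A z.
  by have : setT z by []; rewrite -Fcov => -[A]; exists A.
have /choice[r rP] : forall z, exists e : R, C z ->
    0 < e /\ exists2 A, F A & g @^-1` ball (g z) e `<=` A.
  move=> z; have [Cz|] := pselect (C z); last by exists 0.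
  have [A FA Az] := inF z.
  have : nbhs z A by apply: open_nbhs_nbhs; split=> //; exact: Fo.
  move=> /(cen _ _ Cz)[V /nbhs_ballP[e /= e0 eV] VA].
  by exists e => _; split=> //; exists A => // x /eV /VA.
have /countable_injP[c c_inj] := Ccount.
have fin_before n : finite_set [set t | C t /\ (c t < n)%N].
  set S := (X in finite_set X).
  have /inj_card_eq/eq_finite_set <- : {in S &, injective c}.
    by move=> t u /set_mem[Ct _] /set_mem[Cu _]; apply: c_inj; exact/mem_set.
  by apply: sub_finite_set (finite_II n) => _ [t [_ tn] <-].
pose B z := g @^-1` ball (g z) (r z).
pose L z := B z `\` \bigcup_(t in [set t | C t /\ (c t < c z)%N])
   (g @^-1` [set y | mdist (g t) y <= r t - (c z).+1%:R^-1]).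
pose W := \bigcup_(z in C) B z.
have Bo z : open (B z).
  move/continuousP: metric_or_isolated_continuous; apply.
  exact: open_metric_ball.
have LB z : L z `<=` B z by move=> x [].
have Lo z : open (L z).
  rewrite /L setDE; apply: openI => //; apply: closed_openC.
  apply: closed_bigcup => // t _.
  apply: preimage_closed; last exact: closed_mdist_le.
  by move=> x _; exact: metric_or_isolated_continuous.
have Wo : open W by apply: bigcup_open.
have nWC x : ~ W x -> ~ C x.
  move=> nWx Cx; apply: nWx; exists x => //.
  by apply: ballxx; case: (rP _ Cx).
exists ([set L z | z in C] `|` [set [set z] | z in ~` W]); split.
- split.
  + move=> _ [[z Cz <-//]|[z nWz <-]].
    by rewrite openE => _ ->; exact/iso/nWC.
  + rewrite -subTset => x _; have [Wx|nWx] := pselect (W x); last first.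
      by exists [set x] => //; right; exists x.
    have : exists n, `[< exists z, [/\ C z, B z x & c z = n] >].
      by have [z Cz Bzx] := Wx; exists (c z); apply/asboolP; exists z.
    move=> /ex_minnP[_ /asboolP[z [Cz Bzx <-]] zmin].
    exists (L z); first by left; exists z.
    split=> // -[t [Ct tz] /= tx].
    suff : (c z <= c t)%N by rewrite leqNgt tz.
    apply/zmin/asboolP; exists t; split=> //.
    rewrite /B /= ballEmdist /=; apply: (le_lt_trans tx).
    by rewrite ltrBlDr ltrDl invr_gt0.
- move=> _ [[z Cz <-]|[z nWz <-]].
    by have [_ [A FA BA]] := rP _ Cz; exists A => // x /LB /BA.
  by have [A FA Az] := inF z; exists A => // _ ->.
- move=> x; have [Wx|nWx] := pselect (W x); last first.
    exists [set x]; first exact/iso/nWC.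
    apply: sub_finite_set (finite_set1 [set x]) => A [[]].
      by move=> [z Cz <-] [y [/LB Bzy yx]]; case: nWx; exists z; rewrite -?yx.
    by move=> [z nWz <-] [_ [-> ->]].
  have [t Ct] := Wx; rewrite /B /= ballEmdist /= => tx.
  (* The ball around [t] of radius shrunk by [1 / (N + 1)] still contains [x]. *)
  have /natSinv_lt[N NE] : 0 < r t - mdist (g t) (g x) by rewrite subr_gt0.
  exists (g @^-1` ball (g t) (r t - N.+1%:R^-1) `&` W).
    apply: filterI; last exact: open_nbhs_nbhs.
    apply: metric_or_isolated_continuous; apply: open_nbhs_nbhs; split.
      exact: open_metric_ball.
    by rewrite ballEmdist /= ltrBrDr addrC -ltrBrDr.
  (* When [c z] exceeds both [c t] and [N], [L z] misses the ball around [t]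
     shrunk by [1 / (c z + 1)], which contains the one shrunk by [1 / (N + 1)]. *)
  apply: sub_finite_set (finite_image L (fin_before (maxn (c t) N).+1)).
  move=> A [[[z Cz <-]|[z nWz <-]]]; last first.
    by move=> [_ [-> [_]]].
  move=> [y [[_ nyL] [ty _]]]; exists z => //; split=> //.
  rewrite ltnS leqNgt; apply/negP; rewrite gtn_max => /andP[tz Nz].
  apply: nyL; exists t => //=; move: ty; rewrite /= ballEmdist /= => /ltW ty.
  apply: (le_trans ty); rewrite lerD2l lerN2 lef_pV2 ?posrE//.
  by rewrite ler_nat ltnS ltnW.
Qed.

End theory.

Lemma metric_or_isolated_subtype (Z : topologicalType) (g : Z -> M)
  (C A : set Z) :
  metric_or_isolated g C ->
  metric_or_isolated (g \o (set_val : set_type A -> Z)) (set_val @^-1` C).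
Proof.
move=> [g_inj Ccount iso cen].
have val_nbhs (z : set_type A) V :
    nbhs (set_val z) V -> nbhs z (set_val @^-1` V).
  by move=> zV; exact: initial_continuous.
split.
- by move=> x y /g_inj /val_inj.
- have /countable_injP[c c_inj] := Ccount.
  apply/countable_injP; exists (c \o set_val) => x y; rewrite !inE => Cx Cy.
  by move/c_inj; rewrite !inE => /(_ Cx Cy) /val_inj.
- move=> z nCz; apply: filterS (val_nbhs _ _ (iso _ nCz)) => x.
  exact: val_inj.
- move=> z U Cz; split.
    move=> [_ [[V Vo <-] Vz] VU].
    have /cen[//|W zW WV] : nbhs (set_val z) V by exact: open_nbhs_nbhs.
    by exists W => // x /WV /VU.
  move=> [V zV VU]; apply: (filterS VU).
  by apply: (val_nbhs z (g @^-1` V)); apply/cen => //; exists V.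
Qed.

Lemma metric_or_isolated_hereditarily_paracompact (Z : topologicalType)
  (g : Z -> M) (C : set Z) : metric_or_isolated g C -> hereditarily_paracompact Z.
Proof.
move=> gC A.
exact: metric_or_isolated_paracompact (metric_or_isolated_subtype A gC).
Qed.

Lemma metric_or_isolated_submetrizable (Z : topologicalType) (g : Z -> M)
  (C : set Z) :
  metric_or_isolated g C -> submetrizable R Z.
Proof.
move=> gC; apply: (submetrizable_inj (g := g)); first by case: gC.
exact: metric_or_isolated_continuous gC.
Qed.

End metric_or_isolated.

(** * Isolating the points off a set *)

Section isolated_off.
Context (M : topologicalType) (C : set M).

(** The carrier [M] retopologized so that the points off [C] become isolated; the
Michael line is the case of the rationals in the real line. *)
Definition isolated_off of set M : Type := M.
Local Notation Y := (isolated_off C).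

Let op (U : set Y) := forall y : M, U y -> C y -> nbhs y (U : set M).

Let opT : op setT. Proof. by move=> y _ _; exact: filterT. Qed.

Let opI : setI_closed op.
Proof.
by move=> U V Uo Vo y [Uy Vy] Cy; apply: filterI; [exact: Uo|exact: Vo].
Qed.

Let op_bigU (I : Type) (U : I -> set Y) :
  (forall i, op (U i)) -> op (\bigcup_i U i).
Proof.
move=> Uo y [i _ Uiy] Cy; apply: filterS (Uo i y Uiy Cy).
exact: bigcup_sup.
Qed.

HB.instance Definition _ := Choice.copy Y M.
HB.instance Definition _ := isOpenTopological.Build Y opT opI op_bigU.

Lemma nbhs_isolated_point (y : Y) : ~ C y -> nbhs y [set y].
Proof. by move=> nCy; exists [set y]; split=> // _ ->. Qed.

Lemma nbhs_isolated_off (y : Y) (U : set Y) :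
  C y -> nbhs y U <-> nbhs (y : M) (U : set M).
Proof.
move=> Cy; split=> [[V [Vo Vy VU]]|yU].
  by apply: filterS (Vo y Vy Cy).
exists (@interior M U); split=> //; last exact: (@interior_subset M U).
by move=> z Uz _; exact: (@nbhs_interior M).
Qed.

Lemma closed_isolated_off : closed (C : set Y).
Proof.
rewrite -openC openE => y nCy.
by apply: filterS (nbhs_isolated_point nCy) => _ ->.
Qed.

(** Isolating points off [C] cannot make [C] a G-delta: an open set around [C] in
the finer topology contains one in the original topology. *)
Lemma isolated_off_Gdelta : @Gdelta Y C -> @Gdelta M C.
Proof.
move=> [G Go CG]; exists (fun n => @interior M (G n)).
  by move=> n; exact: open_interior.
apply/seteqP; split=> [y Cy n _|y Gy].
  have : @nbhs _ Y y (G n).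
    by apply: open_nbhs_nbhs; split; [exact: Go|move: Cy; rewrite CG; exact].
  by move/(nbhs_isolated_off _ Cy).
by rewrite CG => n _; apply: interior_subset; exact: Gy.
Qed.

End isolated_off.

Lemma isolated_off_metric_or_isolated (R : realType) (M : metricType R)
  (C : set M) :
  countable C -> metric_or_isolated (idfun : isolated_off C -> M) C.
Proof.
move=> Ccount; split=> //; first exact: nbhs_isolated_point.
move=> y U Cy; split=> [/nbhs_isolated_off yU|[V yV VU]].
  by exists U => //; exact: yU.
by apply/nbhs_isolated_off => //; exact: filterS yV.
Qed.

(** * Closed embeddings and perfect maps *)

Lemma closed_embedding_perfect (Z : topologicalType) (A : set Z) :
  closed A -> perfect_map (set_val : set_type A -> Z).
Proof.
move=> cA; split.
- exact: initial_continuous.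
- move=> F Fc; rewrite -[X in closed X]setCK; apply: open_closedC.
  rewrite openE => y nFy; have [Ay|nAy] := pselect (A y); last first.
    have : nbhs y (~` A).
      by apply: open_nbhs_nbhs; split=> //; exact: closed_openC.
    apply: filterS => z nAz [x _ xz].
    by apply: nAz; rewrite -xz; exact: set_valP.
  pose x : set_type A := exist _ y (mem_set Ay).
  have : nbhs x (~` F).
    apply: open_nbhs_nbhs; split; first exact: closed_openC.
    by move=> Fx; apply: nFy; exists x.
  move=> [_ [[V Vo <-] Vx] VF].
  have : nbhs y V by exact: open_nbhs_nbhs.
  by apply: filterS => w Vw [z Fz zE]; apply: (VF z _ Fz); rewrite /= zE.
- move=> y; have [[x xy]|nx] := pselect (exists x : set_type A, set_val x = y).
    have -> : set_val @^-1` [set y] = [set x]; last exact: compact_set1.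
    apply/seteqP; split=> [z /= zy|_ ->//]; apply: val_inj.
    by rewrite -xy in zy.
  have -> : (set_val : set_type A -> Z) @^-1` [set y] = set0.
    by rewrite -subset0 => x xy; apply: nx; exists x.
  exact: compact0.
Qed.

Lemma range_set_val (T : Type) (A : set T) :
  range (set_val : set_type A -> T) = A.
Proof.
apply/seteqP; split=> [_ [x _ <-]|x Ax]; first exact: set_valP.
by exists (exist _ x (mem_set Ax)).
Qed.

(** The range is closed for the coarser metrizable topology, so it is a G-delta
there, and it remains one for every finer topology. *)
Lemma perfect_submetrizable_Gdelta (R : realType) (X Y : topologicalType)
  (f : X -> Y) : perfect_submetrizable R f -> Gdelta (range f).
Proof.
move=> [sX [sY [_ sYY _ [m mE] [_ fc _]]]].
have := fc setT closedT.
rewrite -openC => oC.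
have : @closed (Metric.Pack m : metricType R) (range f).
  by rewrite -openC mE.
move=> /closed_Gdelta[G Go GE]; exists G => // n.
by apply: sYY; rewrite -mE.
Qed.

Theorem theorem10 (R : realType) :
  exists (X Y : topologicalType) (f : X -> Y),
    [/\ hereditarily_paracompact X, first_countable X & submetrizable R X] /\
    [/\ hereditarily_paracompact Y, first_countable Y & submetrizable R Y] /\
    perfect_map f /\
    ~ perfect_submetrizable R f.
Proof.
(* The metric structure of the real line is carried by the alias [R^o]. *)
pose Q : set R^o := @rational R.
have Qcount : countable Q.
  by apply: card_le_trans (card_image_le _ _) (countableP _).
have YQ := @isolated_off_metric_or_isolated R R^o Q Qcount.
have XQ := metric_or_isolated_subtype (Q : set (isolated_off Q)) YQ.
exists (set_type (Q : set (isolated_off Q))), (isolated_off Q), set_val.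
split.
  split; first exact: metric_or_isolated_hereditarily_paracompact XQ.
    exact: metric_or_isolated_first_countable XQ.
  exact: metric_or_isolated_submetrizable XQ.
split.
  split; first exact: metric_or_isolated_hereditarily_paracompact YQ.
    exact: metric_or_isolated_first_countable YQ.
  exact: metric_or_isolated_submetrizable YQ.
split; first exact: closed_embedding_perfect (@closed_isolated_off _ Q).
move=> /perfect_submetrizable_Gdelta; rewrite range_set_val.
by move=> /isolated_off_Gdelta /not_rational_Gdelta.
Qed.
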